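(* Let $L$ be a finite-dimensional solvable Leibniz $A$-algebra of derived length $n+1$ over a field $F$. Then there are subspaces $A_0,\dots,A_n$ of $L$ such that (i) $L=A_n\dot{+}A_{n-1}\dot{+}\cdots\dot{+}A_0$, where $A_i$ is an abelian subalgebra of $L$ for each $0\le i\le n$; and (ii) $L^{(i)}=A_n\dot{+}A_{n-1}\dot{+}\cdots\dot{+}A_i$ for each $0\le i\le n$.
   Context: A (right) Leibniz algebra over $F$ is a vector space with a bilinear product $[\,,]$ satisfying $[x,[y,z]]=[[x,y],z]-[[x,z],y]$ for all $x,y,z$. Lower central series: $L^1=L$, $L^{k+1}=[L^k,L]$; $L$ is nilpotent if $L^k=0$ for some $k$. Derived series: $L^{(0)}=L$, $L^{(k+1)}=[L^{(k)},L^{(k)}]$; $L$ is solvable of derived length $m$ if $L^{(m)}=0$ but $L^{(m-1)}\ne 0$. $L$ is abelian if $[x,y]=0$ for all $x,y$. $L$ is an $A$-algebra if every nilpotent subalgebra of $L$ is abelian. $\dot{+}$ denotes a vector space direct sum. *)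

(* Defs.v *)
From HB Require Import structures.
From mathcomp Require Import all_boot all_order all_algebra.

Set Implicit Arguments.
Unset Strict Implicit.
Unset Printing Implicit Defensive.

Import GRing.Theory.
Local Open Scope ring_scope.

Section LeibnizAlgebras.

Variables (F : fieldType) (L : vectType F).
Variable br : {bilinear L -> L -> L}.
Implicit Types (U V W : {vspace L}) (x y z : L).

(* A right Leibniz algebra is the vector space L with a bilinear product [br]
   satisfying this identity. *)
Definition leibniz_identity : Prop :=
  forall x y z, br x (br y z) = br (br x y) z - br (br x z) y.

(* [U, V] is the span of all [x, y] with x in U and y in V; by bilinearity,
   bases of U and V suffice (as for [prodv] in falgebra.v). See [bracketvP]. *)
Definition bracketv U V : {vspace L} :=
  <<[seq br x y | x <- vbasis U, y <- vbasis V]>>%VS.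

Lemma memv_bracketv U V x y : x \in U -> y \in V -> br x y \in bracketv U V.
Proof.
move=> Ux Vy; rewrite (coord_vbasis Ux) (coord_vbasis Vy) linear_sumr.
apply: memv_suml => j _; rewrite linear_sumlz; apply: memv_suml => i _.
rewrite linearZr_LR linearZl_LR /= !memvZ // memv_span //.
by apply: allpairs_f; rewrite mem_nth ?size_tuple.
Qed.

Lemma bracketvP U V W :
  reflect (forall x y, x \in U -> y \in V -> br x y \in W)
          (bracketv U V <= W)%VS.
Proof.
apply: (iffP idP) => [sUVW x y Ux Vy | sUVW].
  exact: (subvP sUVW) (memv_bracketv Ux Vy).
apply/span_subvP => _ /allpairsP[[x y] /= [Ux Vy ->]].
by apply: sUVW; apply: vbasis_mem.
Qed.

(* The index is shifted: [lower_central U k] is U^(k+1), so that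
   [lower_central U 0] is U^1 = U. *)
Fixpoint lower_central U (k : nat) : {vspace L} :=
  if k is k'.+1 then bracketv (lower_central U k') U else U.

Fixpoint derived_series U (k : nat) : {vspace L} :=
  if k is k'.+1 then bracketv (derived_series U k') (derived_series U k')
  else U.

Definition subalgebra U : Prop := forall x y, x \in U -> y \in U -> br x y \in U.

Definition abelian_on U : Prop := forall x y, x \in U -> y \in U -> br x y = 0.

Definition nilpotent_on U : Prop := exists k, lower_central U k = 0%VS.

Definition A_algebra : Prop :=
  forall U, subalgebra U -> nilpotent_on U -> abelian_on U.

(* Only m > 0 is meaningful, since L^(m-1) is required to be nonzero. *)
Definition solvable_of_derived_length (m : nat) : Prop :=
  [/\ (0 < m)%N, derived_series fullv m = 0%VS
    & derived_series fullv m.-1 <> 0%VS].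

End LeibnizAlgebras.

(* Main.v *)
(* Each term M of the derived series splits over [M, M] by a subalgebra, which
   is then abelian. By induction on the derived length it suffices to split M
   over its last nonzero derived term B = [N, N]: if M = B (+) H and
   H = [H, H] (+) C, then M = [M, M] (+) C.

   To split M over B, shrink H starting from M. If some right multiplication
   R_d with d in D = H :&: N is not nilpotent on H, replace H by the Fitting null
   component of R_d, a subalgebra since R_d is a derivation; the other component
   lies in B and is moved into an accumulated D-stable subspace Q of B. When no
   such d is left, D is nilpotent, because the R_d commute on B; hence D is
   abelian, and B = [D + Q, D + Q] = [D, Q] + [Q, D] is contained in Q, so that
   Q = B. *)

Require Import Defs.
From HB Require Import structures.
From mathcomp Require Import all_boot all_order all_algebra.

Set Implicit Arguments.
Unset Strict Implicit.
Unset Printing Implicit Defensive.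

Import GRing.Theory.
Local Open Scope ring_scope.

(** * Fitting decomposition and commuting nilpotent endomorphisms *)

Section Fitting.

Variables (F : fieldType) (L : vectType F).
Implicit Types (f g : 'End(L)) (U V W : {vspace L}).

Lemma iter_decreasing (step : {vspace L} -> {vspace L}) U :
  {homo step : V W / (V <= W)%VS} -> (step U <= U)%VS ->
  forall k, (iter k.+1 step U <= iter k step U)%VS.
Proof. by move=> mono sU; elim=> [|k IHk] //=; apply: mono. Qed.

(** The iterates form a descending chain that loses a dimension at every step until it becomes
    constant, so [\dim U] steps suffice. *)
Lemma iter_stable (step : {vspace L} -> {vspace L}) U :
  {homo step : V W / (V <= W)%VS} -> (step U <= U)%VS ->
  step (iter (\dim U) step U) = iter (\dim U) step U.
Proof.
move=> mono sU; have dec := iter_decreasing mono sU.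
suff /(_ (\dim U))[//|] : forall k, step (iter k step U) = iter k step U
    \/ (\dim (iter k step U) + k <= \dim U)%N.
  rewrite -[leqRHS]add0n leq_add2r leqn0 dimv_eq0 => /eqP U0.
  by move: (dec (\dim U)); rewrite /= U0 subv0 => /eqP.
elim=> [|k [IHk|IHk]]; first by right; rewrite addn0.
  by left; rewrite /= !IHk.
have [/eqP eqk|neqk] := boolP (step (iter k step U) == iter k step U).
  by left; rewrite /= !eqk.
right; apply: leq_trans IHk; rewrite addnS -addSn leq_add2r.
by rewrite ltn_neqAle (dimvS (dec k)) (dimv_leqif_eq (dec k)) /= neqk.
Qed.

(** By rank-nullity: [g] maps its image of [U] onto itself, hence is injective there. *)
Lemma fitting_cap g U :
  (g @: (g @: U) = g @: U)%VS -> (g @: U :&: lker g = 0)%VS.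
Proof.
move=> ggU; apply/eqP; rewrite -dimv_eq0 -(eqn_add2r (\dim (g @: U)%VS)).
by rewrite -{2}ggU limg_ker_dim add0n.
Qed.

Lemma fitting_add g U :
  (g @: U <= U)%VS -> (g @: (g @: U) = g @: U)%VS ->
  (U :&: lker g + g @: U = U)%VS.
Proof.
move=> sgU ggU; apply/eqP; rewrite eqEsubv subv_add capvSl sgU /=.
apply/subvP=> x Ux; have: g x \in (g @: (g @: U))%VS by rewrite ggU memv_img.
case/memv_imgP=> y gUy gxy; rewrite -[x](subrK y) memv_add // memv_cap.
by rewrite memvB ?(subvP sgU _ gUy) //= memv_ker linearB /= gxy subrr.
Qed.

Definition exp_lfun f k : 'End(L) := iter k (comp_lfun f) \1%VF.

Lemma exp_lfunE f k x : exp_lfun f k x = iter k f x.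
Proof. by elim: k => [|k IHk]; rewrite /= ?id_lfunE // comp_lfunE IHk. Qed.

Lemma limg_exp f k U : (exp_lfun f k @: U = iter k (lfun_img f) U)%VS.
Proof. by elim: k => [|k IHk] /=; rewrite ?lim1g // limg_comp IHk. Qed.

Lemma limg_exp_sub f k U : (f @: U <= U)%VS -> (exp_lfun f k @: U <= U)%VS.
Proof.
move=> sfU; rewrite limg_exp; elim: k => [|k IHk] //=.
exact: subv_trans (limgS f IHk) sfU.
Qed.

Lemma limg_exp_fixed f U : (f @: U <= U)%VS ->
  let V := (exp_lfun f (\dim U) @: U)%VS in (f @: V = V)%VS.
Proof.
by move=> sfU /=; rewrite limg_exp iter_stable // => V W; apply: limgS.
Qed.

Lemma limg_exp_stable f U : (f @: U <= U)%VS ->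
  let g := exp_lfun f (\dim U) in (g @: (g @: U) = g @: U)%VS.
Proof.
move=> /limg_exp_fixed /= fix_f; rewrite (limg_exp _ _ (_ @: U)).
by elim: {1}(\dim U) => [|k IHk] //=; rewrite IHk.
Qed.

Lemma iter_comm_in f (h : L -> L) U k x :
  (f @: U <= U)%VS -> {in U, forall y, h (f y) = f (h y)} -> x \in U ->
  h (iter k f x) = iter k f (h x).
Proof.
move=> sfU hf Ux; elim: k => //= k <-; rewrite hf // -exp_lfunE.
by rewrite (subvP (limg_exp_sub k sfU)) ?memv_img.
Qed.

(* From [W = f W + S], where S sums the other images and [f S <= S], one gets
   [W = f^k W + S] for all k, so that f can be dropped from the list. *)
Lemma commuting_nilpotent_nakayama (fs : seq 'End(L)) m W :
  {in fs, forall f, (f @: W <= W)%VS} ->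
  {in fs &, forall f g, {in W, forall x, f (g x) = g (f x)}} ->
  {in fs, forall f, (W <= lker (exp_lfun f m))%VS} ->
  (W <= \sum_(f <- fs) f @: W)%VS -> W = 0%VS.
Proof.
elim: fs => [|f fs IHfs] stW comW nilW.
  by rewrite big_nil subv0 => /eqP.
rewrite big_cons; set S := (\sum_(g <- fs) g @: W)%VS => sW.
have fs1 g : g \in fs -> g \in f :: fs by rewrite inE orbC => ->.
have f1 : f \in f :: fs by rewrite mem_head.
have sfS : (f @: S <= S)%VS.
  rewrite /S (big_nth 0) big_mkord limg_sum; apply/subv_sumP => i _.
  apply: (sumv_sup i) => //; apply/subvP=> _ /memv_imgP[_ /memv_imgP[w Ww ->] ->].
  rewrite comW ?f1 ?fs1 ?mem_nth ?memv_img //.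
  by rewrite (subvP (stW f f1)) ?memv_img.
apply: IHfs => [g /fs1|g h /fs1 gf /fs1|g /fs1|];
  [exact: stW|exact: comW|exact: nilW|].
suff: (W <= exp_lfun f m @: W + S)%VS.
  have /eqP-> : (exp_lfun f m @: W == 0)%VS by rewrite -lkerE nilW.
  by rewrite add0v.
elim: m {nilW} => [|k IHk]; first by rewrite lim1g addvSl.
apply: subv_trans sW _; rewrite subv_add addvSr andbT.
apply: subv_trans (limgS f IHk) _; rewrite limgD -limg_comp.
exact: addvS.
Qed.

End Fitting.

(** * Right multiplications and nilpotency *)

Section Leibniz.

Variables (F : fieldType) (L : vectType F).
Variable br : {bilinear L -> L -> L}.
Implicit Types (U V W M N B H Q D I : {vspace L}) (x y z d e : L).

Definition rmul d : 'End(L) := linfun (applyr br d).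

Lemma rmulE d x : rmul d x = br x d.
Proof. exact: lfunE. Qed.

Lemma bracketvS U V U' V' :
  (U <= U')%VS -> (V <= V')%VS -> (bracketv br U V <= bracketv br U' V')%VS.
Proof.
move=> /subvP sU /subvP sV; apply/bracketvP => x y /sU Ux /sV Vy.
exact: memv_bracketv.
Qed.

Lemma subalgebraP U : subalgebra br U <-> (bracketv br U U <= U)%VS.
Proof. by split=> [/bracketvP|/bracketvP]. Qed.

Lemma bracketv_sum_rmul U V :
  (bracketv br U V <= \sum_(f <- [seq rmul d | d <- vbasis V]) f @: U)%VS.
Proof.
apply/bracketvP=> x y Ux Vy; rewrite (coord_vbasis Vy) linear_sumr big_map.
rewrite big_tuple memv_suml // => i _; rewrite linearZr_LR memvZ //.
rewrite (subvP (sumv_sup i _ (subvv _))) //.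
by rewrite (tnth_nth 0) -rmulE memv_img.
Qed.

Lemma lower_centralE U k :
  lower_central br U k = iter k (bracketv br ^~ U) U.
Proof. by elim: k => //= k ->. Qed.

(** An Engel-type criterion. The stable term [W] of the lower central series satisfies [[W, D] = W],
    so it lies in [B], where the right multiplications commute; the Nakayama-type lemma then gives
    [W = 0]. *)
Lemma nilpotent_of_commuting B D m :
  subalgebra br D -> (bracketv br D D <= B)%VS ->
  {in B & D &, forall x d e, br (br x d) e = br (br x e) d} ->
  {in vbasis D, forall d, (D <= lker (exp_lfun (rmul d) m))%VS} ->
  nilpotent_on br D.
Proof.
move=> subD sDB comB nilD; exists (\dim D).
have sDD: (bracketv br D D <= D)%VS by apply/subalgebraP.
have mono : {homo bracketv br ^~ D : V W / (V <= W)%VS}.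
  by move=> V W sVW; apply: bracketvS.
have := iter_stable mono sDD; rewrite -lower_centralE.
set W := lower_central br D _ => stW.
have sWD : (W <= D)%VS.
  rewrite /W; elim: (\dim D) => //= k IHk.
  exact: subv_trans (bracketvS IHk (subvv _)) sDD.
have sWB : (W <= B)%VS.
  by rewrite -stW; apply: subv_trans sDB; apply: bracketvS.
apply: (@commuting_nilpotent_nakayama _ _ [seq rmul d | d <- vbasis D] m).
- move=> _ /mapP[d /vbasis_mem Dd ->].
  apply/subvP=> _ /memv_imgP[w Ww ->]; rewrite rmulE -stW.
  exact: memv_bracketv.
- move=> _ _ /mapP[d /vbasis_mem Dd ->] /mapP[e /vbasis_mem De ->] w Ww.
  by rewrite !rmulE comB // (subvP sWB).
- by move=> _ /mapP[d Dd ->]; apply: subv_trans sWD (nilD d Dd).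
- by rewrite -{1}stW bracketv_sum_rmul.
Qed.

(** * Ideals, derived series and Fitting null components *)

Definition ideal_in M I : Prop :=
  [/\ (I <= M)%VS, (bracketv br M I <= I)%VS & (bracketv br I M <= I)%VS].

Lemma derived_seriesD U j k :
  derived_series br (derived_series br U j) k = derived_series br U (j + k).
Proof. by elim: k => [|k IHk]; rewrite ?addn0 // addnS /= IHk. Qed.

Lemma derived_seriesS U V k :
  (U <= V)%VS -> (derived_series br U k <= derived_series br V k)%VS.
Proof. by move=> sUV; elim: k => //= k IHk; apply: bracketvS. Qed.

Lemma derived_series_sub U k :
  subalgebra br U -> (derived_series br U k <= U)%VS.
Proof.
move=> /subalgebraP sU; elim: k => //= k IHk.
by apply: subv_trans sU; apply: bracketvS.
Qed.

Hypothesis leib : leibniz_identity br.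

Lemma br_derivation x y z : br (br x y) z = br (br x z) y + br x (br y z).
Proof. by rewrite leib addrC subrK. Qed.

Lemma bracketv_ideal U I : ideal_in U I -> ideal_in U (bracketv br I I).
Proof.
case=> sIU /bracketvP sUI /bracketvP sIUI.
have sII := bracketvS sIU (subvv I).
split; first by apply: subv_trans sIU; apply: subv_trans sII _; apply/bracketvP.
  apply/bracketvP => x w Ux Iw; set J := bracketv br I I in Iw *.
  (* An element of [J] is only a sum of brackets; passing to the preimage of [J] under [br x]
     reduces to single brackets. *)
  rewrite -[br x w](lfunE (br x)) memv_preim; apply: subvP Iw.
  apply/bracketvP => y z Iy Iz; rewrite -memv_preim lfunE /= leib.
  by rewrite memvB // memv_bracketv ?sUI ?sIUI.
apply/bracketvP => w x Iw Ux; set J := bracketv br I I in Iw *.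
rewrite -rmulE memv_preim; apply: subvP Iw.
apply/bracketvP => y z Iy Iz; rewrite -memv_preim rmulE br_derivation.
by rewrite memvD // memv_bracketv ?sIUI.
Qed.

Lemma derived_series_ideal U k :
  subalgebra br U -> ideal_in U (derived_series br U k).
Proof.
move=> /subalgebraP sU; elim: k => [|k]; last exact: bracketv_ideal.
by split.
Qed.

Lemma derived_series_subalgebra U k :
  subalgebra br U -> subalgebra br (derived_series br U k).
Proof.
move=> /(derived_series_ideal k)[sIU sUI _]; apply/subalgebraP.
exact: subv_trans (bracketvS sIU (subvv _)) sUI.
Qed.

(** [rmul d] is a derivation, so each application falls on one of the two factors and lowers [a] or
    [b] by one. *)
Lemma iter_rmul_br d a b x y :
  iter a (rmul d) x = 0 -> iter b (rmul d) y = 0 ->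
  iter (a + b) (rmul d) (br x y) = 0.
Proof.
have [s] := ubnP (a + b); elim: s => // s IHs in a b x y *.
case: a => [|a]; first by move=> _ /= -> _; rewrite linear0l -exp_lfunE linear0.
case: b => [|b]; first by move=> _ _ /= ->; rewrite linear0r -exp_lfunE !linear0.
rewrite addSn ltnS => ltabs xa0 yb0; rewrite iterSr rmulE br_derivation.
rewrite -exp_lfunE linearD /= !exp_lfunE.
rewrite -[br x d]rmulE -[br y d]rmulE IHs -?iterSr // addnS -addSn.
by rewrite IHs -?iterSr ?addr0 // addSn -addnS.
Qed.

Lemma null_component_subalgebra H d : subalgebra br H -> d \in H ->
  subalgebra br (H :&: lker (exp_lfun (rmul d) (\dim H)))%VS.
Proof.
move=> subH Hd; set g := exp_lfun _ _ => x y /memv_capP[Hx gx] /memv_capP[Hy gy].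
have sdH : (rmul d @: H <= H)%VS.
  by apply/subvP=> _ /memv_imgP[h Hh ->]; rewrite rmulE subH.
rewrite memv_cap subH //= memv_ker -memv0.
(* The product is only known to be killed by [g] applied twice; hence its image under [g] lies in
   both [g @: H] and [lker g], which meet in 0. *)
rewrite -(fitting_cap (limg_exp_stable sdH)) memv_cap memv_img ?subH //=.
move: gx gy; rewrite !memv_ker !exp_lfunE -iterD => /eqP gx /eqP gy.
exact/eqP/iter_rmul_br.
Qed.

(** * Splitting over derived terms in an A-algebra *)

Hypothesis HA : A_algebra br.

Lemma metabelian_ideal_complement M N : ideal_in M N ->
  let B := bracketv br N N in abelian_on br B ->
  subalgebra br M ->
  exists H, [/\ subalgebra br H, (H + B = M)%VS & (H :&: B = 0)%VS].
Proof.
move=> idN B abB subM; have [sNM /bracketvP sMN /bracketvP sNMN] := idN.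
have subN : subalgebra br N by move=> x y Nx Ny; rewrite sNMN // (subvP sNM).
have sBN : (B <= N)%VS by apply/subalgebraP.
have [_ _ /bracketvP sBMB] := bracketv_ideal idN.
have {sBMB} sBNB b x : b \in B -> x \in N -> br b x \in B.
  by move=> Bb /(subvP sNM); apply: sBMB.
(* The difference of the two sides is [[b, [d, e]]], which lies in [[B, B] = 0]. Together with
   [comlr], both multiplications by [e] commute with [rmul d] on [B]. *)
have comrr b d e : b \in B -> d \in N -> e \in N ->
  br (br b d) e = br (br b e) d.
  move=> Bb Nd Ne; apply/eqP; rewrite -subr_eq0 -leib.
  by rewrite abB // memv_bracketv.
have comlr b d e : b \in B -> d \in N -> e \in N ->
  br (br e b) d = br e (br b d).
  move=> Bb Nd Ne; rewrite br_derivation [br (br e d) b]abB ?add0r //.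
  exact: memv_bracketv.
pose good H Q := [/\ subalgebra br H, (H + Q = M)%VS, (H :&: Q = 0)%VS,
  (Q <= B)%VS & forall d q, d \in (H :&: N)%VS -> q \in Q ->
    br q d \in Q /\ br d q \in Q].
suff loop s H Q : (\dim H < s)%N -> good H Q ->
    exists H', [/\ subalgebra br H', (H' + B = M)%VS & (H' :&: B = 0)%VS].
  apply: (loop (\dim M).+1 M 0%VS) => //.
  split; rewrite ?addv0 ?capv0 ?sub0v // => d q _; rewrite memv0 => /eqP->.
  by rewrite linear0l linear0r mem0v.
elim: s H Q => // s IHs H Q; rewrite ltnS => leHs [subH HQM HQ0 sQB stQ].
set D := (H :&: N)%VS in stQ.
have sHM : (H <= M)%VS by rewrite -HQM addvSl.
have subD : subalgebra br D.
  move=> x y /memv_capP[Hx Nx] /memv_capP[Hy Ny].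
  by rewrite memv_cap subH ?subN.
have sDN : (D <= N)%VS := capvSr H N.
have sDB : (bracketv br D D <= B)%VS by apply: bracketvS.
pose g d := exp_lfun (rmul d) (\dim H).
(* Testing a basis of [D] is enough for [nilpotent_of_commuting], and makes the alternative
   decidable. *)
have [nilD | /allPn[d /vbasis_mem Dd ndH]] :=
  boolP (all (fun d => H <= lker (g d))%VS (vbasis D)).
  have {nilD} abD : abelian_on br D.
    apply: HA => //; apply: (@nilpotent_of_commuting B _ (\dim H)) => //.
      by move=> b x y Bb Dx Dy; rewrite comrr ?(subvP sDN).
    move=> x Dx; apply: subv_trans (capvSl H N) _; exact: (allP nilD).
  (* Modular law, from [M = H + Q] and [Q <= B <= N]. *)
  have sNDQ : (N <= D + Q)%VS.
    apply/subvP=> x Nx; have := subvP sNM x Nx; rewrite -HQM.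
    case/memv_addP=> h Hh [q Qq x_hq]; rewrite x_hq memv_add // memv_cap Hh.
    have -> : h = x - q by rewrite x_hq addrK.
    by rewrite memvB // (subvP sBN) // (subvP sQB).
  have sBQ : (B <= Q)%VS.
    apply/bracketvP=> x y /(subvP sNDQ) + /(subvP sNDQ).
    move=> /memv_addP[d Dd [q Qq ->]] /memv_addP[e De [r Qr ->]].
    rewrite linearDl !linearDr /= abD // add0r [br q r]abB ?(subvP sQB) //.
    by rewrite addr0 memvD //; [have [] := stQ d r | have [] := stQ e q].
  have <- : Q = B by apply/eqP; rewrite eqEsubv sQB sBQ.
  by exists H.
have [Hd Nd] := memv_capP Dd.
have sdH : (rmul d @: H <= H)%VS.
  by apply/subvP=> _ /memv_imgP[h Hh ->]; rewrite rmulE subH.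
pose H0 := (H :&: lker (g d))%VS; pose H1 := (g d @: H)%VS.
have ggH : (g d @: H1 = H1)%VS := limg_exp_stable sdH.
have sgH : (H1 <= H)%VS := limg_exp_sub _ sdH.
have H01 : (H0 + H1 = H)%VS by apply: fitting_add.
have H10 : (H1 :&: H0 = 0)%VS.
  apply/eqP; rewrite -subv0 -(fitting_cap ggH) capvS //.
  exact: capvSr.
(* [H1] is its own image under [rmul d]: a first application lands in [N], a second in [[N, N] =
   B]. *)
have sH1B : (H1 <= B)%VS.
  have fixH1 : (rmul d @: H1 = H1)%VS := limg_exp_fixed sdH.
  rewrite -fixH1 -fixH1.
  apply/subvP=> _ /memv_imgP[_ /memv_imgP[h Hh ->] ->].
  by rewrite !rmulE memv_bracketv // sMN // (subvP sHM) // (subvP sgH).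
apply: (IHs H0 (H1 + Q)%VS).
  apply: leq_trans leHs.
  rewrite ltn_neqAle (dimvS (capvSl _ _)) (dimv_leqif_eq (capvSl _ _)) andbT.
  by apply: contra ndH => /eqP <-; rewrite capvSr.
split.
- exact: null_component_subalgebra.
- by rewrite addvA H01.
- apply/eqP; rewrite -subv0; apply/subvP=> x /memv_capP[H0x].
  case/memv_addP=> h H1h [q Qq x_hq].
  have q0 : q = 0.
    apply/eqP; rewrite -memv0 -HQ0 memv_cap Qq andbT.
    have -> : q = x - h by rewrite x_hq addrC addKr.
    by rewrite memvB ?(subvP sgH h H1h) // (subvP (capvSl _ _) _ H0x).
  by rewrite -H10 memv_cap H0x x_hq q0 addr0 H1h.
- by rewrite subv_add sH1B.
move=> e _ /memv_capP[H0e Ne] /memv_addP[h H1h [q Qq ->]].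
have He : e \in H by rewrite (subvP (capvSl _ _) _ H0e).
have De : e \in D by rewrite memv_cap He.
rewrite linearDl linearDr /=; have [Qqe Qeq] := stQ e q De Qq.
suff [H1he H1eh] : br h e \in H1 /\ br e h \in H1 by rewrite !memv_add.
(* With [h = g d b], multiplication by [e] on either side passes through [g d], leaving [g d]
   applied to a product of elements of [H]. *)
have : h \in (g d @: H1)%VS by rewrite ggH.
case/memv_imgP=> b H1b ->; have Hb := subvP sgH b H1b.
have sdB : (rmul d @: B <= B)%VS.
  by apply/subvP=> _ /memv_imgP[c Bc ->]; rewrite rmulE sBNB.
rewrite /g exp_lfunE.
rewrite (iter_comm_in (h := br^~ e) _ sdB) ?(subvP sH1B) //; last first.
  by move=> c Bc; rewrite !rmulE comrr.
rewrite (iter_comm_in (h := br e) _ sdB) ?(subvP sH1B) //; last first.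
  by move=> c Bc; rewrite !rmulE comlr.
by rewrite -!exp_lfunE !memv_img ?subH.
Qed.

Lemma derived_complement k M :
  subalgebra br M -> derived_series br M k.+1 = 0%VS ->
  exists C, [/\ subalgebra br C, (bracketv br M M + C = M)%VS
              & (bracketv br M M :&: C = 0)%VS].
Proof.
elim: k M => [|k IHk] M subM Mk0.
  by exists M; move: Mk0 => /= ->; rewrite add0v cap0v.
set N := derived_series br M k.
have idN : ideal_in M N by apply: derived_series_ideal.
have abB : abelian_on br (bracketv br N N).
  by move=> x y Bx By; apply/eqP; rewrite -memv0 -Mk0 memv_bracketv.
have [H [subH HBM HB0]] := metabelian_ideal_complement idN abB subM.
set B := bracketv br N N in HBM HB0.
have sHM : (H <= M)%VS by rewrite -HBM addvSl.
(* The derived term of [H] of index [k.+1] lies in [H] and in that of [M], which is [B], so it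
   vanishes. *)
have [||C [subC H1CH H1C0]] := IHk H; first exact: subH.
  apply/eqP; rewrite -subv0 -HB0 subv_cap derived_series_sub //=.
  exact: (derived_seriesS k.+1 sHM).
have sB : (B <= bracketv br M M)%VS.
  by apply: bracketvS; apply: derived_series_sub.
have [_ /bracketvP sMB /bracketvP sBMB] : ideal_in M B := bracketv_ideal idN.
(* Expanding [[h + b, h' + b']], every term but [[h, h']] falls into the ideal [B]. *)
have defM1 : (bracketv br M M = B + bracketv br H H)%VS.
  apply/eqP; rewrite eqEsubv subv_add sB bracketvS // !andbT.
  apply/bracketvP=> x y Mx My; move: (Mx) (My); rewrite -HBM.
  move=> /memv_addP[h Hh [b Bb x_hb]] /memv_addP[h' Hh' [b' Bb' y_hb]].
  rewrite y_hb linearDr /= x_hb linearDl /= -x_hb addrAC -addrA addrC.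
  have Mh' := subvP sHM h' Hh'.
  by rewrite memv_add ?(memv_bracketv br Hh Hh') // memvD ?(sMB x) ?(sBMB b).
have sCH : (C <= H)%VS by rewrite -H1CH addvSr.
exists C; split=> //; first by rewrite defM1 -addvA H1CH addvC.
apply/eqP; rewrite -subv0 defM1; apply/subvP=> x /memv_capP[+ Cx].
case/memv_addP=> b Bb [h H1h x_bh].
have Hh : h \in H by apply: subvP H1h; apply/subalgebraP.
have b0 : b = 0.
  apply/eqP; rewrite -memv0 -HB0 memv_cap Bb andbT.
  have -> : b = x - h by rewrite x_bh addrK.
  by rewrite memvB // (subvP sCH).
by rewrite -H1C0 memv_cap Cx x_bh b0 add0r H1h.
Qed.

End Leibniz.

(** * Assembling the complements *)

Theorem corollary3p3 (F : fieldType) (L : vectType F)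
    (br : {bilinear L -> L -> L}) (n : nat) :
  leibniz_identity br ->
  A_algebra br ->
  solvable_of_derived_length br n.+1 ->
  exists A : 'I_n.+1 -> {vspace L},
    [/\ directv (\sum_(i < n.+1) A i)%VS,
        fullv = (\sum_(i < n.+1) A i)%VS,
        forall i : 'I_n.+1, subalgebra br (A i) /\ abelian_on br (A i)
      & forall i : 'I_n.+1,
          directv (\sum_(j < n.+1 | (i <= j)%N) A j)%VS /\
          derived_series br fullv i = (\sum_(j < n.+1 | (i <= j)%N) A j)%VS].
Proof.
move=> leib HA [_ Ln0 _]; pose Ls := derived_series br fullv.
have subL : subalgebra br fullv by move=> x y _ _; apply: memvf.
have subLs i : subalgebra br (Ls i) := derived_series_subalgebra leib subL.
have /fin_all_exists[A HAs] (i : 'I_n.+1) : exists C : {vspace L},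
    [/\ subalgebra br C, (Ls i.+1 + C = Ls i)%VS & (Ls i.+1 :&: C = 0)%VS].
  apply: (@derived_complement _ _ br leib HA n) => //.
  (* Exchanging the two indices turns the term into the [i]-th derived term of the zero space. *)
  rewrite derived_seriesD addnC -derived_seriesD Ln0.
  apply/eqP; rewrite -subv0 derived_series_sub // => x y.
  by rewrite memv0 => /eqP-> _; rewrite linear0l mem0v.
(* Descending induction from the empty sum at index [n.+1]: [m] counts the summands, and each step
   adds the complement with the next lower index. *)
have sumA m : (m <= n.+1)%N ->
    directv (\sum_(j < n.+1 | (n.+1 - m <= j)%N) A j)%VS /\
    Ls (n.+1 - m)%N = (\sum_(j < n.+1 | (n.+1 - m <= j)%N) A j)%VS.
  elim: m => [|m IHm] ltmn.
    have geF (j : 'I_n.+1) : (n.+1 <= j)%N = false by rewrite leqNgt ltn_ord.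
    by rewrite subn0 directvE /= !big_pred0 ?dimv0.
  have [/directvP /= dirm defm] := IHm (ltnW ltmn).
  have lti : (n.+1 - m.+1 < n.+1)%N by rewrite ltn_subrL.
  have [_ addA capA] := HAs (Ordinal lti).
  have defi : (n.+1 - m.+1).+1 = (n.+1 - m)%N by rewrite -subSn.
  rewrite /= defi in addA capA; rewrite directvE /=.
  have eqi (j : 'I_n.+1) :
      ((n.+1 - m.+1 <= j)%N && (j != Ordinal lti)) = (n.+1 - m <= j)%N.
    by rewrite -defi ltn_neqAle andbC eq_sym.
  have <- : Ls (n.+1 - m.+1)%N = (\sum_(j < n.+1 | (n.+1 - m.+1 <= j)%N) A j)%VS.
    by rewrite -addA (bigD1 (Ordinal lti)) //= (eq_bigl _ _ eqi) -defm addvC.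
  rewrite (bigD1 (Ordinal lti)) //= (eq_bigl _ _ eqi) -dirm -defm -addA.
  by rewrite dimv_disjoint_sum // addnC.
have {}sumA i : (i <= n.+1)%N ->
    directv (\sum_(j < n.+1 | (i <= j)%N) A j)%VS /\
    Ls i = (\sum_(j < n.+1 | (i <= j)%N) A j)%VS.
  by move=> /subKn <-; apply: sumA; apply: leq_subr.
have [dir0 def0] := sumA 0%N isT.
exists A; split=> //; last by move=> i; apply: sumA; apply: ltnW.
move=> i; have [subA addA cap0] := HAs i; split=> // x y Ax Ay.
have sALs : (A i <= Ls i)%VS by rewrite -addA addvSr.
(* A product of elements of [A i] lies in [A i] and in [Ls i.+1], which meet in 0. *)
apply/eqP; rewrite -memv0 -cap0 memv_cap subA // andbT.
by rewrite memv_bracketv // (subvP sALs).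
Qed.
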